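(* Let $(M,g)$ be a Riemannian manifold (finite- or infinite-dimensional), $A^1,\dots,A^d$ $(1,1)$-tensor fields and $Q$ a tangent vector field on $M$, and suppose that the equation $\frac{\partial u}{\partial t}+\sum_{j}A^j\frac{\partial u}{\partial x^j}=Q|_u$ satisfies the equilibrium assumption (E) on $(M,g)$, with equilibrium manifold $\iota:\tilde M\to M$ and projection $\pi$. Let $i:\hat M\to M$ be an embedded submanifold, $\hat g:=i^*g$, and $p:M\to\hat M$ a projection, i.e. a smooth map with $p\circ i=\mathrm{id}_{\hat M}$. Assume that (1) $\iota(\tilde M)\subset i(\hat M)$; and (2) for each $\hat u\in\hat M$: $p_*Q|_{i(\hat u)}=0\in T_{\hat u}\hat M$ if and only if $Q|_{i(\hat u)}=0\in T_{i(\hat u)}M$. If the original equation satisfies GSC (resp. GUSC or GWSC) on $(M,g)$, then the reduced model $$\frac{\partial\hat u}{\partial t}+\sum_j\hat A^j\frac{\partial\hat u}{\partial x^j}=\hat Q|_{\hat u},\qquad\hat A^j:=p_*\circ A^j\circ i_*,\quad\hat Q:=p_*\circ Q\circ i,$$ on $\hat M$ satisfies GSC (resp. GUSC or GWSC) on $(\hat M,\hat g)$. Here the reduced model is considered with equilibrium manifold $\tilde M$, embedding $\hat\iota:=i^{-1}\circ\iota:\tilde M\to\hat M$ and projection $\hat\pi:=\pi\circ i$.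
   Context: $(1,1)$-tensor fields are regarded as fibrewise linear maps $TM\to TM$; $i_*,p_*,\iota_*,\pi_*$ are differentials, with $p_*$ applied at points $i(\hat u)$ and $\pi_*$ at points $\iota(\tilde u)$. (If $A^j|_u$ is only densely defined, identities involving $A^jX$ are understood for $X|_u$ in its domain, and $i_*T_{\hat u}\hat M$ is assumed closed with the domain of $\hat A^j|_{\hat u}$ dense in $T_{\hat u}\hat M$.) Equilibrium assumption (E) for an equation $\partial_tu+\sum_jA^j\partial_{x^j}u=Q|_u$ on $(M,g)$: the set $\tilde M:=\{u\in M: Q|_u=0\}$ is a smooth embedded submanifold of $M$, with embedding $\iota:\tilde M\to M$, and there is a projection $\pi:U\to\tilde M$ defined on an open set $U\subset M$ containing the equilibrium manifold such that $\pi\circ\iota=\mathrm{id}_{\tilde M}$ and $g(X,\iota_*\tilde Y)|_{\iota(\tilde u)}=\tilde g(\pi_*X,\tilde Y)|_{\tilde u}$ for all $\tilde u\in\tilde M$, $X\in\Gamma(TM)$, $\tilde Y\in\Gamma(T\tilde M)$, where $\tilde g:=\iota^*g$. Let $D$ be the Levi-Civita connection of $(M,g)$. Consider the conditions: (i) for each $\tilde u\in\tilde M$ and $X\in\Gamma(TM)$: $D_{\iota_*\pi_*X}Q|_{\iota(\tilde u)}=0$ and $\iota_*\pi_*D_XQ|_{\iota(\tilde u)}=0$; (ii) $g(A^jX,Y)=g(X,A^jY)$ for all $X,Y\in\Gamma(TM)$, $j=1,\dots,d$; (iii) for each $\tilde u\in\tilde M$ and $X\in\Gamma(TM)$ with $X|_{\iota(\tilde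 u)}\ne0$ and $\iota_*\pi_*X|_{\iota(\tilde u)}=0$: $g(D_XQ,X)|_{\iota(\tilde u)}<0$; (iv) for each $\tilde u\in\tilde M$ and each $X\in\Gamma(TM)$, there exists a constant $\lambda>0$ such that $g(D_XQ,X)|_{\iota(\tilde u)}\le-\lambda\|X-\iota_*\pi_*X\|_g^2|_{\iota(\tilde u)}$; (v) for each $\tilde u\in\tilde M$ and each $X\in\Gamma(TM)$: $g(D_XQ,X)|_{\iota(\tilde u)}\le0$. The equation satisfies the generalized stability condition (GSC) if (i),(ii),(iii) hold; the generalized uniform stability condition (GUSC) if (i),(ii),(iv) hold; the generalized weak stability condition (GWSC) if (i),(ii),(v) hold. The same definitions apply to the reduced model with $(\hat M,\hat g,\hat A^j,\hat Q,\hat\iota,\hat\pi)$.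
   Formalization: The projection p is additionally assumed orthogonal along the submanifold, g(X, i_*Y) = ĝ(p_*X, Y) at points of i(M̂), as (E) requires of π; without this the reduced tensors p_*A^j i_* need not be symmetric and the claim is false. *)

(* Defs.v *)
From HB Require Import structures.
From mathcomp Require Import all_boot all_order all_algebra.
From mathcomp Require Import all_classical all_reals all_analysis.
Set Implicit Arguments.
Unset Strict Implicit.
Unset Printing Implicit Defensive.
Import Order.TTheory GRing.Theory Num.Theory.
Import numFieldNormedType.Exports.
Local Open Scope classical_set_scope.
Local Open Scope ring_scope.

(* f is C^n on the open set U.  The derivative is taken in the form of the
   tangent map (x, v) |-> 'd f x v on U x E, which avoids a norm on the space of
   continuous linear maps.  For a fixed finite n this is slightly weaker than
   Frechet C^n in infinite dimension, but requiring it for all n gives exactly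
   the Frechet C^oo maps (C^(n+1) in this sense implies Frechet C^n). *)
Fixpoint Cn_on (R : realType) (n : nat) (E F : normedModType R)
    (U : set E) (f : E -> F) {struct n} : Prop :=
  if n is m.+1 then
    (forall x, U x -> differentiable f x) /\
    @Cn_on R m (E * E)%type F (U `*` setT) (fun z => 'd f (z.1) (z.2))
  else forall x, U x -> {for x, continuous f}.

Definition smooth_on (R : realType) (E F : normedModType R)
    (U : set E) (f : E -> F) : Prop := forall n, Cn_on n U f.

(* A Hausdorff smooth manifold modelled on the Banach space E (finite- or
   infinite-dimensional), with a preferred chart [chart u] around each point u;
   the charts [chart u], u a point, form the atlas.  [chart u] and its inverse
   [cinv u] are total functions which are meaningful on [cdom u] and on
   [chart u @` cdom u] only. *)
Record manifold (R : realType) (E : completeNormedModType R) := Manifold {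
  point :> topologicalType;
  chart : point -> point -> E;
  cinv : point -> E -> point;
  cdom : point -> set point;
  manifold_hausdorff : hausdorff_space point;
  cdom_open : forall u, open (cdom u);
  cdom_center : forall u, cdom u u;
  ccod_open : forall u, open (chart u @` cdom u);
  chartK : forall u v, cdom u v -> cinv u (chart u v) = v;
  chart_continuous : forall u v, cdom u v -> {for v, continuous (chart u)};
  cinv_continuous : forall u x, (chart u @` cdom u) x ->
    {for x, continuous (cinv u)};
  transition_smooth : forall u v,
    smooth_on (chart u @` (cdom u `&` cdom v)) (chart v \o cinv u)
}.

(* A tangent vector at u is given by its components in the preferred chart at
   u. *)
Definition tangent (R : realType) (E : completeNormedModType R)
    (M : manifold E) (u : M) : normedModType R := E.

Section Fields.
Context {R : realType} {E : completeNormedModType R}.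
Implicit Types (M : manifold E).

Definition smooth_fun_at M (f : M -> R) (u : M) : Prop :=
  exists2 V : set E, open_nbhs (chart u u) V &
    smooth_on V (f \o cinv u : E -> R^o).

Definition dfun M (f : M -> R) (u : M) (v : tangent u) : R :=
  'd (f \o cinv u : E -> R^o) (chart u u) v.

Definition section M := forall u : M, tangent u.

(* component function, in the chart around u, of the vector field X *)
Definition field_rep M (u : M) (X : section M) : E -> E :=
  fun x => let v := cinv u x in 'd (chart u \o cinv v) (chart v v) (X v).

Definition smooth_field_at M (X : section M) (u : M) : Prop :=
  exists2 V : set E, open_nbhs (chart u u) V & smooth_on V (field_rep u X).

Definition lie_bracket M (X Y : section M) : section M := fun u =>
  'd (field_rep u Y) (chart u u) (X u) - 'd (field_rep u X) (chart u u) (Y u).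

Definition metric M := forall u : M, tangent u -> tangent u -> R.

(* component function, in the chart around u, of the metric g *)
Definition metric_rep M (u : M) (g : metric M) : E * (E * E) -> R := fun z =>
  let v := cinv u z.1 in
  g v ('d (chart v \o cinv u) (z.1) (z.2.1)) ('d (chart v \o cinv u) (z.1) (z.2.2)).

(* In infinite dimension g is not required to induce the topology of the model
   space: both strong and weak Riemannian metrics are covered. *)
Definition riemannian M (g : metric M) : Prop :=
  [/\ forall u v w, g u v w = g u w v,
      forall u a v w z, g u (a *: v + w) z = a * g u v z + g u w z,
      forall u v, v != 0 -> 0 < g u v v &
      forall u, exists2 V : set E, open_nbhs (chart u u) V &
        smooth_on (V `*` setT) (metric_rep u g : (E * (E * E))%type -> R^o)].

Definition gnorm M (g : metric M) (u : M) (v : tangent u) : R :=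
  Num.sqrt (g u v v).

(* [D u v X] is the covariant derivative of X in the direction v of T_u M. *)
Definition connection M := forall u : M, tangent u -> section M -> tangent u.

(* Sections are total functions, so the axioms are imposed, at each point u, on
   the sections that are smooth near u. *)
Definition levi_civita M (g : metric M) (D : connection M) : Prop :=
  (forall u a v w X, smooth_field_at X u ->
    D u (a *: v + w) X = a *: D u v X + D u w X) /\
  (forall u v X Y, smooth_field_at X u -> smooth_field_at Y u ->
    D u v (fun w => X w + Y w) = D u v X + D u v Y) /\
  (forall u v (f : M -> R) X, smooth_fun_at f u -> smooth_field_at X u ->
    D u v (fun w => f w *: X w) = dfun f v *: X u + f u *: D u v X) /\
  (forall u X Y, smooth_field_at X u -> smooth_field_at Y u ->
    smooth_field_at (fun w => D w (X w) Y) u) /\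
  (forall u v X Y, smooth_field_at X u -> smooth_field_at Y u ->
    dfun (fun w => g w (X w) (Y w)) v = g u (D u v X) (Y u) + g u (X u) (D u v Y)) /\
  (forall u X Y, smooth_field_at X u -> smooth_field_at Y u ->
    D u (X u) Y - D u (Y u) X = lie_bracket X Y u).

End Fields.

Section Maps.
Context {R : realType} {E F : completeNormedModType R}.
Implicit Types (M : manifold E) (N : manifold F).

Definition smooth_at M N (f : M -> N) (u : M) : Prop :=
  {for u, continuous f} /\
  exists2 V : set E, open_nbhs (chart u u) V &
    smooth_on V (chart (f u) \o f \o cinv u).

(* the differential f_* at u *)
Definition dmap M N (f : M -> N) (u : M) : tangent u -> tangent (f u) :=
  'd (chart (f u) \o f \o cinv u) (chart u u).

(* the image of L is closed and has a closed complement (the latter is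
   automatic in finite dimension and in Hilbertable model spaces) *)
Definition split_range (L : E -> F) : Prop :=
  closed (range L) /\
  exists K : set F,
    [/\ closed K,
        K 0 /\ (forall a v w, K v -> K w -> K (a *: v + w)),
        range L `&` K = [set 0] &
        forall w, exists v k, K k /\ w = L v + k].

(* a smooth immersion that is a homeomorphism onto its image *)
Definition embedding M N (f : M -> N) : Prop :=
  [/\ forall u, smooth_at f u,
      forall u, injective (dmap f (u := u)) /\ split_range (dmap f (u := u)),
      injective f &
      forall O : set M, open O -> exists2 O' : set N, open O' & O = f @^-1` O'].

Definition pullback_metric M N (f : M -> N) (g : metric N) : metric M :=
  fun u v w => g (f u) (dmap f v) (dmap f w).

End Maps.

(* A (1,1)-tensor field is a family of linear maps T_u M -> T_u M, possibly
   unbounded: [top A u] is only relevant on the dense subspace [tdom A u].  An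
   everywhere defined tensor field has [tdom A u = setT]. *)
Record tensor11 (R : realType) (E : completeNormedModType R)
    (M : manifold E) := Tensor11 {
  tdom : forall u : M, set (tangent u);
  top : forall u : M, tangent u -> tangent u
}.

Section System.
Context {R : realType} {E Et : completeNormedModType R}.
Context {M : manifold E} {Mt : manifold Et}.
Implicit Types (g : metric M) (D : connection M) (Q : section M).
Implicit Types (A : tensor11 M) (iota : Mt -> M) (pi : M -> option Mt).

Definition densely_defined A : Prop := forall u : M,
  [/\ dense (tdom A (u := u)),
      tdom A (0 : tangent u) /\
      (forall a (v w : tangent u), tdom A v -> tdom A w -> tdom A (a *: v + w)) &
      forall a (v w : tangent u), tdom A v -> tdom A w ->
        top A (a *: v + w) = a *: top A v + top A w].

(* The projection pi, defined on an open subset of M, is encoded as a partial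
   map M -> option Mt, whose domain is the set of all u with [pi u] of the form
   [Some _].  Wherever [pi u = Some w], the total map [odflt w \o pi] coincides
   with pi on the domain of pi. *)
Definition pi_star iota pi (ut : Mt) : tangent (iota ut) -> tangent ut :=
  dmap (odflt ut \o pi) (u := iota ut).

Definition iota_pi iota pi (ut : Mt) : tangent (iota ut) -> tangent (iota ut) :=
  fun v => dmap iota (pi_star pi v).

Definition equilibrium g Q iota pi : Prop :=
  embedding iota /\
  range iota = [set u | Q u = 0] /\
  open [set u | pi u] /\
  (forall u w, pi u = Some w -> smooth_at (odflt w \o pi) u) /\
  (forall ut, pi (iota ut) = Some ut) /\
  (forall ut X (Yt : section Mt),
    smooth_field_at X (iota ut) -> smooth_field_at Yt ut ->
    g (iota ut) (X (iota ut)) (dmap iota (Yt ut)) =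
    pullback_metric iota g (pi_star pi (X (iota ut))) (Yt ut)).

(* In the following conditions, the vector fields X, Y are the sections which
   are smooth near the point under consideration; all the expressions depend
   only on their value at that point. *)

Definition cond_i D Q iota pi : Prop :=
  forall ut X, smooth_field_at X (iota ut) ->
    D (iota ut) (iota_pi pi (X (iota ut))) Q = 0 /\
    iota_pi pi (D (iota ut) (X (iota ut)) Q) = 0.

Definition cond_ii (d : nat) (A : 'I_d -> tensor11 M) g : Prop :=
  forall j u X Y, smooth_field_at X u -> smooth_field_at Y u ->
    tdom (A j) (X u) -> tdom (A j) (Y u) ->
    g u (top (A j) (X u)) (Y u) = g u (X u) (top (A j) (Y u)).

Definition cond_iii g D Q iota pi : Prop :=
  forall ut X, smooth_field_at X (iota ut) ->
    X (iota ut) != 0 -> iota_pi pi (X (iota ut)) = 0 ->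
    g (iota ut) (D (iota ut) (X (iota ut)) Q) (X (iota ut)) < 0.

Definition cond_iv g D Q iota pi : Prop :=
  forall ut X, smooth_field_at X (iota ut) ->
    exists2 lambda : R, 0 < lambda &
      g (iota ut) (D (iota ut) (X (iota ut)) Q) (X (iota ut)) <=
      - lambda * gnorm g (X (iota ut) - iota_pi pi (X (iota ut))) ^+ 2.

Definition cond_v g D Q iota : Prop :=
  forall ut X, smooth_field_at X (iota ut) ->
    g (iota ut) (D (iota ut) (X (iota ut)) Q) (X (iota ut)) <= 0.

Definition GSC d (A : 'I_d -> tensor11 M) g D Q iota pi : Prop :=
  [/\ cond_i D Q iota pi, cond_ii A g & cond_iii g D Q iota pi].

Definition GUSC d (A : 'I_d -> tensor11 M) g D Q iota pi : Prop :=
  [/\ cond_i D Q iota pi, cond_ii A g & cond_iv g D Q iota pi].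

Definition GWSC d (A : 'I_d -> tensor11 M) g D Q iota pi : Prop :=
  [/\ cond_i D Q iota pi, cond_ii A g & cond_v g D Q iota].

End System.

Section Reduction.
Context {R : realType} {E Eh Et : completeNormedModType R}.
Context {M : manifold E} {Mh : manifold Eh} {Mt : manifold Et}.
Context (i : Mh -> M) (p : M -> Mh).

(* The values below have type [tangent (p (i uh))], which is [tangent uh] when
   p \o i is the identity. *)
Definition reduced_source (Q : section M) : section Mh :=
  fun uh => dmap p (Q (i uh)).

Definition reduced_tensor (A : tensor11 M) : tensor11 Mh :=
  {| tdom := fun uh => [set v : tangent uh | tdom A (dmap i v)];
     top := fun uh v => dmap p (top A (dmap i v)) |}.

(* i^-1 o iota *)
Definition reduced_embedding (iota : Mt -> M) (H : range iota `<=` range i) :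
    Mt -> Mh :=
  fun ut => s2val (cid2 (H (iota ut) (imageT iota ut))).

End Reduction.

(* Main.v *)
Require Import Defs.
From HB Require Import structures.
From mathcomp Require Import all_boot all_order all_algebra.
From mathcomp Require Import all_classical all_reals all_analysis.
Set Implicit Arguments.
Unset Strict Implicit.
Unset Printing Implicit Defensive.
Import Order.TTheory GRing.Theory Num.Theory.
Import numFieldNormedType.Exports.
Local Open Scope classical_set_scope.
Local Open Scope ring_scope.

(* At a zero [u] of [Q] the covariant derivative [D_X Q] is the linearization
   of [Q], whatever the torsion-free connection.  The chain rule then gives
   [Dh_X Qh = p_* D_{i_* X} Q] at equilibria, without any Gauss formula.
   Orthogonality of [p_*] makes [i_* p_*] self-adjoint, so the reduced quadratic
   forms are the original ones evaluated at [i_* X]; together with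
   [iota_* = i_* iotah_*] and the orthogonality of [pi_*] it also gives
   [pi_* i_* p_* = pi_*], which transports condition (i). *)

(** * Calculus of [Cn_on] maps on open sets *)

(** Charts are meaningful only on their domains, so identities between chart expressions hold only
    near a point. The first-order expansion of [f] passes to [h], and uniqueness of the differential
    concludes. *)
Lemma near_eq_diff (R : realType) (E F : normedModType R) (f h : E -> F) x :
  (\forall y \near x, f y = h y) -> differentiable f x ->
  differentiable h x /\ 'd h x = 'd f x :> (E -> F).
Proof.
move=> fh df.
have [dfc /eqaddoP dfo] := (diff_locallyP x f).1 df.
have dho : h \o shift x = cst (h x) + 'd f x +o_ 0 id.
  apply/eqaddoP => e e0; have fh0 : \forall y \near 0, f (y + x) = h (y + x).
    by rewrite (near_shift 0 x) in fh; apply: filterS fh => y /=; rewrite subr0.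
  apply: filterS2 fh0 (dfo e e0) => y /= fhy.
  by rewrite /= !fctE /= fhy -(nbhs_singleton fh).
have dE : 'd h x = 'd f x :> (E -> F) by
  apply: (@diff_unique R E F h ('d f x) x).
have dh : differentiable h x by apply/diff_locallyP; rewrite dE.
exact: (conj dh dE).
Qed.

Lemma Cn_on_sub (R : realType) n (E F : normedModType R) (U V : set E)
  (f : E -> F) : V `<=` U -> Cn_on n U f -> Cn_on n V f.
Proof.
elim: n => [|n IH] in E F U V f *; first by move=> VU fU x /VU /fU.
move=> VU [df dfU]; split=> [x /VU /df //|].
by apply: IH dfU => z [/VU].
Qed.

Lemma open_setXT (R : realType) (E F : normedModType R) (U : set E) :
  open U -> open (U `*` [set: F]).
Proof.
move=> oU; have -> : U `*` [set: F] = fst @^-1` U.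
  by apply/seteqP; split=> [z []//|z Uz]; split.
by apply: open_comp => // z _; exact: cvg_fst.
Qed.

Lemma Cn_on_ext (R : realType) n (E F : normedModType R) (U : set E)
  (f h : E -> F) : open U -> {in U, f =1 h} -> Cn_on n U f -> Cn_on n U h.
Proof.
move=> oU; elim: n => [|n IH] in E F U f h oU *; move=> fh.
  move=> fU x Ux; change (h @ x --> h x); rewrite -(fh x) ?inE//.
  apply: cvg_trans (fU x Ux); apply: near_eq_cvg.
  by apply: filterS (open_nbhs_nbhs (conj oU Ux)) => y Uy; rewrite fh ?inE.
have nfh x : U x -> \forall y \near x, f y = h y.
  move=> Ux; apply: filterS (open_nbhs_nbhs (conj oU Ux)) => y Uy.
  by rewrite fh ?inE.
move=> [df dfU]; split=> [x Ux|].
  by have [] := near_eq_diff (nfh x Ux) (df x Ux).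
apply: IH dfU; first exact: open_setXT.
move=> z; rewrite inE => -[Uz _].
exact/esym/(congr1 (@^~ _) (proj2 (near_eq_diff (nfh _ Uz) (df _ Uz)))).
Qed.

Lemma Cn_on_S (R : realType) n (E F : normedModType R) (U : set E)
  (f : E -> F) : Cn_on n.+1 U f -> Cn_on n U f.
Proof.
elim: n => [|n IH] in E F U f *; move=> [df dfU].
  by move=> x Ux; apply: differentiable_continuous; exact: df.
by split=> //; apply: IH.
Qed.

(** The tangent map of a linear map is [f \o snd], again linear and continuous, so the induction
    closes. *)
Lemma Cn_on_linear (R : realType) n (E F : normedModType R) (U : set E)
  (f : {linear E -> F}) : open U -> continuous f -> Cn_on n U f.
Proof.
elim: n => [|n IH] in E F U f *; move=> oU cf; first by move=> x _; exact: cf.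
split=> [x _|]; first exact: linear_differentiable.
have cf2 : continuous (f \o (snd : E * E -> E)).
  by move=> z; apply: continuous_comp; [exact: cvg_snd|exact: cf].
apply: (Cn_on_ext _ _ (IH _ _ (U `*` setT) (f \o snd)%FUN _ cf2)).
- exact: open_setXT.
- by move=> z _; rewrite diff_lin.
- exact: open_setXT.
Qed.

Lemma Cn_on_cst (R : realType) n (E F : normedModType R) (U : set E) (c : F) :
  open U -> Cn_on n U (cst c).
Proof.
elim: n => [|n IH] in E c U *; move=> oU; first by move=> x _; exact: cvg_cst.
split=> [x _|]; first exact: differentiable_cst.
apply: (Cn_on_ext _ _ (IH _ 0 (U `*` setT) _)).
- exact: open_setXT.
- by move=> z _; rewrite diff_cst.
- exact: open_setXT.
Qed.

Lemma Cn_on_pair (R : realType) n (E F G : normedModType R) (U : set E)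
  (f : E -> F) (h : E -> G) : open U ->
  Cn_on n U f -> Cn_on n U h -> Cn_on n U (fun x => (f x, h x)).
Proof.
elim: n => [|n IH] in E F G U f h *; move=> oU.
  by move=> fU hU x Ux; apply: cvg_pair; [exact: fU|exact: hU].
move=> [df fU] [dh hU]; split=> [x Ux|].
  by apply: differentiable_pair; [exact: df|exact: dh].
apply: (Cn_on_ext _ _ (IH _ _ _ _ _ _ _ fU hU)); try exact: open_setXT.
move=> z; rewrite inE => -[Uz _].
by rewrite (diff_pair (df _ Uz) (dh _ Uz)).
Qed.

(** By the chain rule the tangent map of [h \o f] is that of [h] after the pair of [f \o fst] and
    the tangent map of [f]. Both components have order [n], the first one through [Cn_on_S]. *)
Lemma Cn_on_comp (R : realType) n (E F G : normedModType R) (U : set E)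
  (V : set F) (f : E -> F) (h : F -> G) : open U -> open V ->
  (forall x, U x -> V (f x)) -> Cn_on n U f -> Cn_on n V h ->
  Cn_on n U (h \o f).
Proof.
elim: n => [|n IH] in E F G U V f h *; move=> oU oV UV.
  by move=> fU hV x Ux; apply: continuous_comp; [exact: fU|exact/hV/UV].
move=> fS [dh hV]; have [df fU] := fS; split=> [x Ux|].
  by apply: differentiable_comp; [exact: df|exact/dh/UV].
have oUT := open_setXT (F := E) oU.
have f1 : Cn_on n (U `*` setT) (f \o (fst : E * E -> E)).
  apply: (IH _ _ _ _ U) => //; first by move=> z [].
    by apply: (@Cn_on_linear _ _ _ _ _ fst) => // z; exact: cvg_fst.
  exact: Cn_on_S.
apply: (Cn_on_ext oUT _
  (IH _ _ _ _ (V `*` setT) _ _ oUT _ _ (Cn_on_pair oUT f1 fU) hV)).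
- move=> z; rewrite inE => -[Uz _] /=.
  by rewrite (diff_comp (df _ Uz) (dh _ (UV _ Uz))).
- exact: open_setXT.
- by move=> z [Uz _]; split=> //; exact: UV.
Qed.

(** * Germs of smooth maps *)

(** [smooth_field_at] and the second half of [smooth_at] unfold to this form, so facts on germs
    apply to them by conversion. *)
Definition smooth_near (R : realType) (E F : normedModType R) (x : E)
    (f : E -> F) : Prop :=
  exists2 V : set E, open_nbhs x V & smooth_on V f.

Lemma smooth_near_differentiable (R : realType) (E F : normedModType R) (x : E)
  (f : E -> F) : smooth_near x f -> differentiable f x.
Proof. by move=> [V [oV Vx] /(_ 1%N) [df _]]; exact: df. Qed.

Lemma smooth_near_ext (R : realType) (E F : normedModType R) (x : E)
  (f h : E -> F) : (\forall y \near x, f y = h y) ->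
  smooth_near x f -> smooth_near x h.
Proof.
rewrite /prop_near1 nbhsE => -[W [oW Wx] fh] [V [oV Vx] fV].
exists (V `&` W); first by split=> //; exact: openI.
move=> n; apply: (Cn_on_ext (f := f)); first exact: openI.
  by move=> y; rewrite inE => -[_ /fh].
by apply: Cn_on_sub (fV n) => y [].
Qed.

Lemma smooth_near_cst (R : realType) (E F : normedModType R) (x : E) (c : F) :
  smooth_near x (cst c).
Proof.
by exists setT; [exact: open_nbhsT|move=> n; apply: Cn_on_cst; exact: openT].
Qed.

Lemma smooth_near_pair (R : realType) (E F G : normedModType R) (x : E)
  (f : E -> F) (h : E -> G) : smooth_near x f -> smooth_near x h ->
  smooth_near x (fun y => (f y, h y)).
Proof.
move=> [V [oV Vx] fV] [W [oW Wx] hW].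
have oVW := openI oV oW; exists (V `&` W) => // n.
by apply: Cn_on_pair => //; [apply: Cn_on_sub (fV n)|apply: Cn_on_sub (hW n)]
  => y [].
Qed.

Lemma smooth_near_comp (R : realType) (E F G : normedModType R) (x : E)
  (f : E -> F) (h : F -> G) : smooth_near x f -> smooth_near (f x) h ->
  smooth_near x (h \o f).
Proof.
move=> [V [oV Vx] fV] [W [oW Wx] hW].
have cf : {for x, continuous f} by have := fV 0%N; exact.
have : nbhs x (f @^-1` W) by apply: cf; exact: open_nbhs_nbhs.
rewrite nbhsE => -[U [oU Ux] UW].
have oVU := openI oV oU; exists (V `&` U) => // n.
apply: (Cn_on_comp (V := W)) => //; first by move=> y [_ /UW].
by apply: Cn_on_sub (fV n) => y [].
Qed.

(** Order [n.+1] of [Cn_on] contains order [n] of the tangent map. *)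
Lemma smooth_near_tangent (R : realType) (E F : normedModType R) (x v : E)
  (f : E -> F) : smooth_near x f ->
  smooth_near (x, v) (fun z : E * E => 'd f (z.1) (z.2)).
Proof.
move=> [V [oV Vx] fV]; exists (V `*` setT); last by move=> n; case: (fV n.+1).
by split; [exact: open_setXT|split].
Qed.

Lemma diff_comp_at (R : realType) (E F G : normedModType R) (x v : E)
  (f : E -> F) (h : F -> G) : differentiable f x -> differentiable h (f x) ->
  'd (h \o f) x v = 'd h (f x) ('d f x v).
Proof. by move=> df dh; exact: (congr1 (@^~ v) (diff_comp df dh)). Qed.

Lemma eq_near_diff (R : realType) (E F : normedModType R) (f h : E -> F) x v :
  (\forall y \near x, f y = h y) -> differentiable f x -> 'd h x v = 'd f x v.
Proof. by move=> fh df; exact: (congr1 (@^~ v) (near_eq_diff fh df).2). Qed.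

(* The second derivative of [f] does not contribute, as it is evaluated on the
   vanishing vector [q x]. *)
Lemma diff_tangent_at_zero (R : realType) (E F G : normedModType R) (x v : E)
  (f : F -> G) (k q : E -> F) :
  smooth_near (k x) f -> differentiable k x -> differentiable q x -> q x = 0 ->
  'd (fun y => 'd f (k y) (q y)) x v = 'd f (k x) ('d q x v).
Proof.
move=> sf dk dq q0; pose T (z : F * F) := 'd f (z.1) (z.2).
have dT : differentiable T (k x, 0).
  exact: smooth_near_differentiable (smooth_near_tangent 0 sf).
have df := smooth_near_differentiable sf.
have dkq : differentiable (fun y => (k y, q y)) x by exact: differentiable_pair.
have dI (z : F) : is_diff z (fun y : F => y) id := is_diff_id z.
(* [T] vanishes along the zero section, so its derivative in the base direction is zero there. *)
have T1 a : 'd T (k x, 0) (a, 0) = 0.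
  have dp : differentiable (fun y : F => (y, 0 : F)) (k x).
    exact: differentiable_pair (@ex_diff _ _ _ _ _ _ _ (dI _))
      (differentiable_cst 0 _).
  have pE : 'd (fun y : F => (y, 0 : F)) (k x) a = (a, 0).
    rewrite (diff_pair (@ex_diff _ _ _ _ _ _ _ (dI _))
      (differentiable_cst 0 _)) /=.
    by rewrite diff_cst (@diff_val _ _ _ _ _ _ _ (dI _)).
  rewrite -pE -(diff_comp_at _ dp dT).
  have -> : T \o (fun y => (y, 0)) = cst 0 by apply/funext => y; exact: linear0.
  by rewrite diff_cst.
(* On the fibre over [k x], [T] is the continuous linear map ['d f (k x)], hence its own
   derivative. *)
have T2 b : 'd T (k x, 0) (0, b) = 'd f (k x) b.
  have dp : differentiable (fun y : F => (k x, y)) 0.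
    exact: differentiable_pair (differentiable_cst (k x) _)
      (@ex_diff _ _ _ _ _ _ _ (dI _)).
  have pE : 'd (fun y : F => (k x, y)) 0 b = (0, b).
    rewrite (diff_pair (differentiable_cst (k x) _)
      (@ex_diff _ _ _ _ _ _ _ (dI _))) /=.
    by rewrite diff_cst (@diff_val _ _ _ _ _ _ _ (dI _)).
  rewrite -pE -(diff_comp_at (f := fun y => (k x, y)) _ dp dT).
  exact: (congr1 (@^~ b) (diff_lin (f := 'd f (k x)) _ (diff_continuous df))).
rewrite -[LHS]/('d (T \o (fun y => (k y, q y))) x v).
have dT' : differentiable T (k x, q x) by rewrite q0.
rewrite (diff_comp_at _ dkq dT') (diff_pair dk dq) q0.
have -> : ('d k x v, 'd q x v) = ('d k x v, 0) + (0, 'd q x v).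
  by congr pair; rewrite /= ?addr0 ?add0r.
by rewrite linearD T1 T2 add0r.
Qed.

(* Maps between manifolds in charts *)
#[local] Hint Resolve cdom_center : core.

(** The preferred charts used by [dmap] change with the point; the free indices [a] and [b] keep the
    charts fixed while the point moves. *)
Definition local_rep (R : realType) (E F : completeNormedModType R)
    (M : manifold E) (N : manifold F) (f : M -> N) (a : M) (b : N) : E -> F :=
  chart b \o f \o cinv a.

Lemma near_cinv (R : realType) (E : completeNormedModType R) (M : manifold E)
  (a u : M) (P : set M) : cdom a u -> nbhs u P ->
  \forall x \near chart a u, P (cinv a x).
Proof.
move=> au Pu; have : {for chart a u, continuous (cinv a)}.
  by apply: cinv_continuous; exists u.
by apply; rewrite chartK.
Qed.

Lemma near_cdom (R : realType) (E : completeNormedModType R) (M : manifold E)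
  (u a : M) : cdom a u -> \forall v \near u, cdom a v.
Proof. by move=> au; apply: open_nbhs_nbhs; split=> //; exact: cdom_open. Qed.

Lemma near_ccod (R : realType) (E : completeNormedModType R) (M : manifold E)
  (a u : M) : cdom a u -> \forall x \near chart a u, (chart a @` cdom a) x.
Proof.
move=> au; apply: open_nbhs_nbhs; split; first exact: ccod_open.
by exists u.
Qed.

Lemma near_cinvK (R : realType) (E : completeNormedModType R) (M : manifold E)
  (a u : M) : cdom a u -> \forall x \near chart a u, chart a (cinv a x) = x.
Proof.
move=> /near_ccod; apply: filterS => x [v av <-].
by rewrite chartK.
Qed.

(** [transition_smooth] speaks of the image of the whole overlap; an open neighbourhood inside this
    image gives the germ. *)
Lemma smooth_near_transition (R : realType) (E : completeNormedModType R)
  (M : manifold E) (a b u : M) : cdom a u -> cdom b u ->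
  smooth_near (chart a u) (chart b \o cinv a).
Proof.
move=> au bu.
have : \forall x \near chart a u, (chart a @` cdom a) x /\ cdom b (cinv a x).
  exact: filterI (near_ccod au) (near_cinv au (near_cdom bu)).
rewrite /prop_near1 nbhsE => -[W oW WU]; exists W => // n.
apply: Cn_on_sub (@transition_smooth _ _ M a b n) => x /WU [[v av <-]].
by rewrite chartK // => bv; exists v.
Qed.

(** [cinv b] undoes [chart b] only on [cdom b]; continuity of [f] keeps the images of nearby points
    there. *)
Lemma local_rep_comp_near (R : realType) (E F G : completeNormedModType R)
  (M : manifold E) (N : manifold F) (P : manifold G) (f : M -> N) (h : N -> P)
  (a u : M) (b : N) (c : P) :
  {for u, continuous f} -> cdom a u -> cdom b (f u) ->
  \forall x \near chart a u,
    (local_rep h b c \o local_rep f a b) x = local_rep (h \o f) a c x.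
Proof.
move=> cf au bfu; have : \forall v \near u, cdom b (f v).
  by apply: cf; exact: near_cdom.
move=> /(near_cinv au); apply: filterS => x bx.
by rewrite /local_rep /= chartK.
Qed.

(** [smooth_at] fixes the preferred charts. Inserting the identity of [M] before [f], and that of
    [N] after it, turns both changes of chart into compositions. *)
Lemma smooth_near_rep (R : realType) (E F : completeNormedModType R)
  (M : manifold E) (N : manifold F) (f : M -> N) (a u : M) (b : N) :
  smooth_at f u -> cdom a u -> cdom b (f u) ->
  smooth_near (chart a u) (local_rep f a b).
Proof.
move=> [cf sf] au bfu.
have cidu : {for u, continuous (@id M)} by exact: cvg_id.
apply: (smooth_near_ext (local_rep_comp_near f b cidu au (cdom_center u))).
apply: smooth_near_comp; first exact: smooth_near_transition.
rewrite /local_rep /= chartK //.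
apply: (smooth_near_ext (local_rep_comp_near id b cf
  (cdom_center u) (cdom_center (f u)))).
apply: smooth_near_comp; first exact: sf.
by rewrite /local_rep /= chartK //; apply: smooth_near_transition.
Qed.

Lemma smooth_at_comp (R : realType) (E F G : completeNormedModType R)
  (M : manifold E) (N : manifold F) (P : manifold G) (f : M -> N) (h : N -> P)
  (u : M) : smooth_at f u -> smooth_at h (f u) -> smooth_at (h \o f) u.
Proof.
move=> [cf sf] [ch sh]; split; first exact: continuous_comp.
apply: (smooth_near_ext (local_rep_comp_near h (h (f u)) cf
  (cdom_center u) (cdom_center (f u)))).
apply: smooth_near_comp; first exact: sf.
by rewrite /local_rep /= chartK.
Qed.

Lemma smooth_at_id (R : realType) (E : completeNormedModType R)
  (M : manifold E) (u : M) : smooth_at (@id M) u.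
Proof. by split; [exact: cvg_id|apply: smooth_near_transition]. Qed.

(** Taking [f] or [h] to be the identity, this chain rule also yields the changes of chart for
    differentials. *)
Lemma diff_local_rep_comp (R : realType) (E F G : completeNormedModType R)
  (M : manifold E) (N : manifold F) (P : manifold G) (f : M -> N) (h : N -> P)
  (a u : M) (b : N) (c : P) v : smooth_at f u -> smooth_at h (f u) ->
  cdom a u -> cdom b (f u) -> cdom c (h (f u)) ->
  'd (local_rep (h \o f) a c) (chart a u) v =
  'd (local_rep h b c) (chart b (f u)) ('d (local_rep f a b) (chart a u) v).
Proof.
move=> sf sh au bfu chfu.
have df := smooth_near_differentiable (smooth_near_rep sf au bfu).
have fE : local_rep f a b (chart a u) = chart b (f u).
  by rewrite /local_rep /= chartK.
have dh : differentiable (local_rep h b c) (local_rep f a b (chart a u)).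
  by rewrite fE; exact: smooth_near_differentiable (smooth_near_rep sh bfu chfu).
rewrite -fE -(diff_comp_at _ df dh).
apply: eq_near_diff; last exact: differentiable_comp.
exact: local_rep_comp_near sf.1 au bfu.
Qed.

Lemma diff_local_rep_id (R : realType) (E : completeNormedModType R)
  (M : manifold E) (a u : M) v : cdom a u ->
  'd (local_rep (@id M) a a) (chart a u) v = v.
Proof.
move=> au; have [dI dIE] := is_diff_id (chart a u).
have idE : \forall x \near chart a u, x = local_rep (@id M) a a x.
  by apply: filterS (near_cinvK au) => x xE; rewrite /local_rep /= xE.
by rewrite (eq_near_diff v idE dI) dIE.
Qed.

Lemma dmap_comp (R : realType) (E F G : completeNormedModType R)
  (M : manifold E) (N : manifold F) (P : manifold G) (f : M -> N) (h : N -> P)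
  (u : M) (v : tangent u) : smooth_at f u -> smooth_at h (f u) ->
  dmap (h \o f) v = dmap h (dmap f v).
Proof.
move=> sf sh.
by apply: (@diff_local_rep_comp _ _ _ _ M N P f h u u (f u) (h (f u)) v sf sh).
Qed.

Lemma dmap_id (R : realType) (E : completeNormedModType R) (M : manifold E)
  (u : M) (v : tangent u) : dmap (@id M) v = v.
Proof. exact: diff_local_rep_id. Qed.

Lemma dmap_continuous (R : realType) (E F : completeNormedModType R)
  (M : manifold E) (N : manifold F) (f : M -> N) (u : M) :
  smooth_at f u -> continuous (dmap f (u := u)).
Proof.
move=> [_ sf].
exact: diff_continuous (smooth_near_differentiable sf).
Qed.

(* The vector field with constant components [c] in the chart around [u]. *)
Definition const_field (R : realType) (E : completeNormedModType R)
    (M : manifold E) (u : M) (c : tangent u) : section M :=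
  fun v => 'd (local_rep (@id M) u v) (chart u v) c.

Lemma const_field_id (R : realType) (E : completeNormedModType R)
  (M : manifold E) (u : M) (c : tangent u) : const_field c u = c.
Proof. exact: diff_local_rep_id. Qed.

(** Passing to the chart at a nearby point and back is the identity, so the representative around
    [u] is constant. Such fields turn conditions on smooth fields into conditions on single tangent
    vectors. *)
Lemma const_field_smooth (R : realType) (E : completeNormedModType R)
  (M : manifold E) (u : M) (c : tangent u) : smooth_field_at (const_field c) u.
Proof.
apply: (smooth_near_ext _ (smooth_near_cst (chart u u) c)).
apply: filterS (near_ccod (cdom_center u)) => x [v uv <-].
rewrite /field_rep /= chartK //.
rewrite -[RHS](@diff_local_rep_comp _ _ _ _ M M M id id u v v u c) //.
- exact/esym/diff_local_rep_id.
- exact: smooth_at_id.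
- exact: smooth_at_id.
Qed.

(* At a zero of [Y] the torsion identity [D_X Y - D_Y X = [X, Y]] has no term
   [D_Y X], so every torsion-free connection gives the linearization of [Y]. *)
Lemma levi_civita_at_zero (R : realType) (E : completeNormedModType R)
  (M : manifold E) (g : metric M) (D : connection M) (Y : section M) (u : M)
  (v : tangent u) : levi_civita g D -> smooth_field_at Y u -> Y u = 0 ->
  D u v Y = 'd (field_rep u Y) (chart u u) v.
Proof.
move=> [Dlin [_ [_ [_ [_ Dtor]]]]] sY Y0.
have sX := const_field_smooth v; have := Dtor u _ _ sX sY.
have D0 : D u 0 (const_field v) = 0.
  have := Dlin u 1 0 0 _ sX; rewrite !scale1r addr0 => /esym/eqP.
  by rewrite -subr_eq0 addrK => /eqP.
rewrite /lie_bracket const_field_id Y0 D0 subr0 => ->.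
by rewrite -[RHS]subr0; congr (_ - _); exact: linear0.
Qed.

(** * The reduced source term in charts *)

(** The left-hand side is the tangent map of [p] along the pair formed by [i] and by [Q] over [i].
    Its outer charts are fixed, so it can be differentiated in [x]. *)
Lemma reduced_source_rep (R : realType) (E Eh : completeNormedModType R)
  (M : manifold E) (Mh : manifold Eh) (i : Mh -> M) (p : M -> Mh)
  (Q : section M) (uh : Mh) :
  smooth_at i uh -> (forall u, smooth_at p u) -> (forall vh, p (i vh) = vh) ->
  \forall x \near chart uh uh,
    'd (local_rep p (i uh) uh) (local_rep i uh (i uh) x)
      (field_rep (i uh) Q (local_rep i uh (i uh) x)) =
    field_rep uh (reduced_source i p Q) x.
Proof.
move=> si sp pi.
have iU : \forall vh \near uh, cdom (i uh) (i vh) by apply: si.1; exact: near_cdom.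
have : \forall x \near chart uh uh, (chart uh @` cdom uh) x /\
    cdom (i uh) (i (cinv uh x)).
  exact: filterI (near_ccod (cdom_center uh)) (near_cinv (cdom_center uh) iU).
apply: filterS => x [[vh uvh <-]]; rewrite chartK // => iuvh.
rewrite /field_rep /local_rep /= !chartK //.
have pU : cdom uh (p (i vh)) by rewrite pi.
(* Reading [p] as [p \o id] absorbs the change of chart of [Q]; reading it as [id \o p] then brings
   out that of the reduced source. *)
rewrite -[LHS](@diff_local_rep_comp _ _ _ _ M M Mh id p (i vh) (i vh) (i uh) uh
  (Q (i vh)) (smooth_at_id _) (sp _)) //.
rewrite [LHS](@diff_local_rep_comp _ _ _ _ M Mh Mh p id (i vh) (i vh) (p (i vh))
  uh (Q (i vh)) (sp _) (smooth_at_id _)) //.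
by rewrite /reduced_source /dmap -/(local_rep p _ _) pi.
Qed.

Lemma reduced_source_smooth (R : realType) (E Eh : completeNormedModType R)
  (M : manifold E) (Mh : manifold Eh) (i : Mh -> M) (p : M -> Mh)
  (Q : section M) (uh : Mh) :
  smooth_at i uh -> (forall u, smooth_at p u) -> (forall vh, p (i vh) = vh) ->
  smooth_field_at Q (i uh) -> smooth_field_at (reduced_source i p Q) uh.
Proof.
move=> si sp pi sQ; apply: (smooth_near_ext (reduced_source_rep Q si sp pi)).
have iE : local_rep i uh (i uh) (chart uh uh) = chart (i uh) (i uh).
  by rewrite /local_rep /= chartK.
have pU : cdom uh (p (i uh)) by rewrite pi.
have sP := smooth_near_rep (sp (i uh)) (cdom_center (i uh)) pU.
apply: (smooth_near_comp (f := fun x => (local_rep i uh (i uh) x,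
  field_rep (i uh) Q (local_rep i uh (i uh) x)))
  (h := fun z => 'd (local_rep p (i uh) uh) (z.1) (z.2))).
  apply: smooth_near_pair; first exact: si.2.
  by apply: smooth_near_comp; [exact: si.2|rewrite iE].
by apply: smooth_near_tangent; rewrite iE.
Qed.

(** The representative of [Q] along [i] is zero at the base point, so [diff_tangent_at_zero] removes
    the second derivative of [p]. *)
Lemma diff_reduced_source (R : realType) (E Eh : completeNormedModType R)
  (M : manifold E) (Mh : manifold Eh) (i : Mh -> M) (p : M -> Mh)
  (Q : section M) (uh : Mh) (v : tangent uh) :
  smooth_at i uh -> (forall u, smooth_at p u) -> (forall vh, p (i vh) = vh) ->
  smooth_field_at Q (i uh) -> Q (i uh) = 0 ->
  'd (field_rep uh (reduced_source i p Q)) (chart uh uh) v =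
  dmap p ('d (field_rep (i uh) Q) (chart (i uh) (i uh)) (dmap i v)
          : tangent (i uh)).
Proof.
move=> si sp pi sQ Q0.
have iE : local_rep i uh (i uh) (chart uh uh) = chart (i uh) (i uh).
  by rewrite /local_rep /= chartK.
have pU : cdom uh (p (i uh)) by rewrite pi.
have sP := smooth_near_rep (sp (i uh)) (cdom_center (i uh)) pU.
pose q := field_rep (i uh) Q \o local_rep i uh (i uh).
have dI : differentiable (local_rep i uh (i uh)) (chart uh uh).
  exact: smooth_near_differentiable si.2.
have dQ : differentiable (field_rep (i uh) Q) (local_rep i uh (i uh) (chart uh uh)).
  by rewrite iE; exact: smooth_near_differentiable sQ.
have dq : differentiable q (chart uh uh) by exact: differentiable_comp.
have q0 : q (chart uh uh) = 0.
  by rewrite /q /= iE /field_rep chartK // Q0 linear0.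
have sP' : smooth_near (local_rep i uh (i uh) (chart uh uh))
  (local_rep p (i uh) uh) by rewrite iE.
(* [p (i uh)] and [uh] are equal only through the hypothesis [pi]. As every tangent space is the
   model space, it is enough to rewrite the index of the target chart. *)
have pE (w : tangent (i uh)) :
    dmap p w = 'd (local_rep p (i uh) uh) (chart (i uh) (i uh)) w.
  by have := congr1 (fun b => 'd (local_rep p (i uh) b) (chart (i uh) (i uh)) w)
    (pi uh).
have dT : differentiable (fun y => 'd (local_rep p (i uh) uh)
    (local_rep i uh (i uh) y) (q y)) (chart uh uh).
  apply: (differentiable_comp (f := fun x => (local_rep i uh (i uh) x, q x))
    (g := fun z => 'd (local_rep p (i uh) uh) (z.1) (z.2))).
    exact: differentiable_pair.
  by apply: smooth_near_differentiable; apply: smooth_near_tangent.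
rewrite (eq_near_diff v (reduced_source_rep Q si sp pi) dT) pE.
by rewrite (diff_tangent_at_zero v sP' dI dq q0) (diff_comp_at _ dI dQ) iE.
Qed.

(** The reduced source vanishes at [uh] as well, so both covariant derivatives are
    linearizations. *)
Lemma reduced_source_covariant (R : realType) (E Eh : completeNormedModType R)
  (M : manifold E) (Mh : manifold Eh) (g : metric M) (gh : metric Mh)
  (D : connection M) (Dh : connection Mh) (i : Mh -> M) (p : M -> Mh)
  (Q : section M) (uh : Mh) (v : tangent uh) :
  levi_civita g D -> levi_civita gh Dh ->
  smooth_at i uh -> (forall u, smooth_at p u) -> (forall vh, p (i vh) = vh) ->
  smooth_field_at Q (i uh) -> Q (i uh) = 0 ->
  Dh uh v (reduced_source i p Q) = dmap p (D (i uh) (dmap i v) Q).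
Proof.
move=> lc lch si sp pi sQ Q0; rewrite (levi_civita_at_zero _ lc sQ Q0).
rewrite (levi_civita_at_zero _ lch (reduced_source_smooth si sp pi sQ)).
  exact: diff_reduced_source.
by rewrite /reduced_source Q0 /dmap linear0.
Qed.

(** * Split ranges and elementary facts on metrics and differentials *)

(** [T \o L] is a continuous projector: its range is its fixed set, hence closed, and the kernel of
    [L] is a closed complement. *)
Lemma split_range_left_inverse (R : realType) (E F : completeNormedModType R)
  (T : {linear E -> F}) (L : {linear F -> E}) :
  continuous T -> continuous L -> cancel T L -> split_range T.
Proof.
move=> cT cL TK.
have c0 (G : completeNormedModType R) : closed [set (0 : G)].
  exact/accessible_closed_set1/hausdorff_accessible/norm_hausdorff.
split.
  have -> : range T = (fun w => T (L w) - w) @^-1` [set 0].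
    apply/seteqP; split=> [_ [v _ <-]|w /= /eqP]; first by rewrite /= TK subrr.
    by rewrite subr_eq0 => /eqP <-; exists (L w).
  apply: closed_comp; last exact: c0.
  move=> w _; apply: (@cvgB _ _ _ (nbhs w) _ (T \o L) id); last exact: cvg_id.
  by apply: continuous_comp; [exact: cL|exact: cT].
exists (L @^-1` [set 0]); split.
- by apply: closed_comp; [move=> w _; exact: cL|exact: c0].
- split; first exact: linear0.
  by move=> a v w /= v0 w0; rewrite linearP v0 w0 scaler0 addr0.
- apply/seteqP; split=> [_ [[v _ <-]]|_ ->] /=.
    by rewrite TK => ->; rewrite linear0.
  by split; [exists 0 => //; exact: linear0|exact: linear0].
- move=> w; exists (L w), (w - T (L w)); split; last by rewrite addrC subrK.
  by rewrite /= linearB TK subrr.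
Qed.

Lemma reduced_embeddingK (R : realType) (E Eh Et : completeNormedModType R)
  (M : manifold E) (Mh : manifold Eh) (Mt : manifold Et) (i : Mh -> M)
  (iota : Mt -> M) (H : range iota `<=` range i) (ut : Mt) :
  i (reduced_embedding H ut) = iota ut.
Proof. by rewrite /reduced_embedding; case: cid2. Qed.

Lemma metricBl (R : realType) (E : completeNormedModType R) (M : manifold E)
  (g : metric M) (u : M) (v w z : tangent u) : riemannian g ->
  g u (v - w) z = g u v z - g u w z.
Proof.
move=> [_ glin _ _]; have := glin u (-1) w v z.
by rewrite scaleN1r addrC => ->; rewrite mulN1r addrC.
Qed.

Lemma metric_eq0 (R : realType) (E : completeNormedModType R) (M : manifold E)
  (g : metric M) (u : M) (v : tangent u) : riemannian g -> g u v v = 0 -> v = 0.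
Proof.
move=> [_ _ gpos _] gv; apply/eqP/negP => /negP v0.
by have := gpos u v v0; rewrite gv ltxx.
Qed.

Lemma dmapB (R : realType) (E F : completeNormedModType R) (M : manifold E)
  (N : manifold F) (f : M -> N) (u : M) (v w : tangent u) :
  dmap f (v - w) = dmap f v - dmap f w.
Proof. by rewrite /dmap linearB. Qed.

Lemma dmap0 (R : realType) (E F : completeNormedModType R) (M : manifold E)
  (N : manifold F) (f : M -> N) (u : M) : dmap f (0 : tangent u) = 0.
Proof. by rewrite /dmap linear0. Qed.

(** * Inheritance of equilibria and stability by the reduced model *)

Theorem theorem5 (R : realType) (E Eh Et : completeNormedModType R)
  (M : manifold E) (Mh : manifold Eh) (Mt : manifold Et)
  (g : metric M) (g_riem : riemannian g)
  (D : connection M) (D_lc : levi_civita g D)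
  (d : nat) (A : 'I_d -> tensor11 M)
  (A_dense : forall j, densely_defined (A j))
  (Q : section M) (Q_smooth : forall u, smooth_field_at Q u)
  (iota : Mt -> M) (pi : M -> option Mt)
  (eq_E : equilibrium g Q iota pi)
  (i : Mh -> M) (i_emb : embedding i)
  (Dh : connection Mh) (Dh_lc : levi_civita (pullback_metric i g) Dh)
  (p : M -> Mh) (p_smooth : forall u, smooth_at p u)
  (p_i : forall uh, p (i uh) = uh)
  (p_orth : forall uh (X : section M) (Yh : section Mh),
    smooth_field_at X (i uh) -> smooth_field_at Yh uh ->
    g (i uh) (X (i uh)) (dmap i (Yh uh)) =
    pullback_metric i g (dmap p (X (i uh)) : tangent uh) (Yh uh))
  (Ah_dense : forall j (uh : Mh), dense (tdom (reduced_tensor i p (A j)) (u := uh)))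
  (iota_i : range iota `<=` range i)
  (Q_zero : forall uh, dmap p (Q (i uh)) = 0 <-> Q (i uh) = 0) :
  let gh := pullback_metric i g in
  let Ah := fun j => reduced_tensor i p (A j) in
  let Qh := reduced_source i p Q in
  let iotah := reduced_embedding iota_i in
  let pih := pi \o i in
  equilibrium gh Qh iotah pih /\
  (GSC A g D Q iota pi -> GSC Ah gh Dh Qh iotah pih) /\
  (GUSC A g D Q iota pi -> GUSC Ah gh Dh Qh iotah pih) /\
  (GWSC A g D Q iota pi -> GWSC Ah gh Dh Qh iotah pih).
Proof.
move=> gh Ah Qh iotah pih.
have [iota_emb [iota_Q [pi_open [pi_smooth [pi_iota pi_orth0]]]]] := eq_E.
have [iota_smooth iota_imm iota_inj iota_top] := iota_emb.
have [i_smooth i_imm i_inj _] := i_emb.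
have [gC _ _ _] := g_riem.
have i_iotah ut : i (iotah ut) = iota ut by exact: (reduced_embeddingK iota_i ut).
have iotaE : iota = i \o iotah by apply/funext => ut; rewrite /= i_iotah.
(* Preimages under [i] were merely chosen; this factorization is what makes [iotah] smooth. *)
have iotahE : iotah = p \o iota.
  by apply/funext => ut; rewrite /= -i_iotah p_i.
have iotah_smooth ut : smooth_at iotah ut.
  by rewrite iotahE; exact: smooth_at_comp (iota_smooth ut) (p_smooth _).
have Q_iota ut : Q (i (iotah ut)) = 0.
  have : range iota (iota ut) by exists ut.
  by rewrite iota_Q i_iotah.
(* The base points [iota ut] and [i (iotah ut)] are not convertible, so equalities of vectors are
   stated in the model space. *)
have dmap_iota ut (v : Et) : @dmap _ _ _ Mt M iota ut v =
    @dmap _ _ _ Mh M i (iotah ut) (@dmap _ _ _ Mt Mh iotah ut v) :> E.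
  have := @dmap_comp _ _ _ _ Mt Mh M iotah i ut v (iotah_smooth _) (i_smooth _).
  by rewrite -iotaE.
have pi_smooth_iota ut : smooth_at (odflt ut \o pi) (iota ut).
  exact: pi_smooth.
have pi_starE ut (v : Eh) : @pi_star _ _ _ Mh Mt iotah pih ut v =
    @pi_star _ _ _ M Mt iota pi ut (@dmap _ _ _ Mh M i (iotah ut) v) :> Et.
  have sp : smooth_at (odflt ut \o pi) (i (iotah ut)) by rewrite i_iotah.
  have := @dmap_comp _ _ _ _ Mh M Mt i (odflt ut \o pi) (iotah ut) v
    (i_smooth _) sp.
  by rewrite i_iotah.
have pi_starK ut (v : Et) :
    @pi_star _ _ _ M Mt iota pi ut (@dmap _ _ _ Mt M iota ut v) = v :> Et.
  have := @dmap_comp _ _ _ _ Mt M Mt iota (odflt ut \o pi) ut v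
    (iota_smooth _) (pi_smooth_iota _).
  (* The default [ut] never enters, because [pi] is defined on the whole image of [iota]. *)
  have -> : (odflt ut \o pi) \o iota = id.
    by apply/funext => wt; rewrite /= pi_iota.
  by rewrite dmap_id => /esym.
have pi_orth ut (x : E) (y : Et) :
    g (iota ut) x (@dmap _ _ _ Mt M iota ut y) =
    g (iota ut) (@dmap _ _ _ Mt M iota ut (@pi_star _ _ _ M Mt iota pi ut x))
      (@dmap _ _ _ Mt M iota ut y).
  have := pi_orth0 ut _ _ (@const_field_smooth _ _ M (iota ut) x)
    (@const_field_smooth _ _ Mt ut y).
  by rewrite !const_field_id.
have p_orthE uh (x : E) (y : Eh) :
    g (i uh) x (@dmap _ _ _ Mh M i uh y) =
    g (i uh) (@dmap _ _ _ Mh M i uh (@dmap _ _ _ M Mh p (i uh) x))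
      (@dmap _ _ _ Mh M i uh y).
  have := p_orth uh _ _ (@const_field_smooth _ _ M (i uh) x)
    (@const_field_smooth _ _ Mh uh y).
  by rewrite !const_field_id.
have gi ut (x y : E) : g (i (iotah ut)) x y = g (iota ut) x y.
  by rewrite i_iotah.
have p_orth_iota ut (x : E) (y : Eh) :
    g (iota ut) x (@dmap _ _ _ Mh M i (iotah ut) y) =
    g (iota ut) (@dmap _ _ _ Mh M i (iotah ut) (@dmap _ _ _ M Mh p (iota ut) x))
      (@dmap _ _ _ Mh M i (iotah ut) y).
  have := p_orthE (iotah ut) x y.
  by rewrite i_iotah.
have pi_ip ut (x : E) : @pi_star _ _ _ M Mt iota pi ut
    (@dmap _ _ _ Mh M i (iotah ut) (@dmap _ _ _ M Mh p (iota ut) x)) =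
    @pi_star _ _ _ M Mt iota pi ut x :> Et.
  (* It suffices that [iota_* z] has zero norm. In its first slot [pi_orth] removes [iota_* pi_*];
     in the second, [iota_* z = i_* iotah_* z], so [p_orth_iota] makes the two terms cancel. *)
  apply/subr0_eq; set z := _ - _; apply: (iota_imm ut).1; rewrite dmap0.
  apply: (metric_eq0 g_riem).
  rewrite {1}(dmapB iota _ _ : @dmap _ _ _ Mt M iota ut z = _).
  rewrite (metricBl _ _ _ g_riem) -!pi_orth dmap_iota.
  by rewrite -p_orth_iota subrr.
have DhE ut (v : Eh) : Dh (iotah ut) v Qh = @dmap _ _ _ M Mh p (iota ut)
    (D (iota ut) (@dmap _ _ _ Mh M i (iotah ut) v) Q) :> Eh.
  have := @reduced_source_covariant _ _ _ M Mh g gh D Dh i p Q (iotah ut) v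
    D_lc Dh_lc (i_smooth _) p_smooth p_i (Q_smooth _) (Q_iota _).
  by rewrite i_iotah.
have ghD ut (v : Eh) : gh (iotah ut) (Dh (iotah ut) v Qh) v =
    g (iota ut) (D (iota ut) (@dmap _ _ _ Mh M i (iotah ut) v) Q)
      (@dmap _ _ _ Mh M i (iotah ut) v).
  by rewrite /gh /pullback_metric gi DhE -p_orth_iota.
have Ii : cond_i D Q iota pi -> cond_i Dh Qh iotah pih.
  move=> ci ut X _; rewrite /iota_pi; move: (X (iotah ut)) => {X} x.
  have [ci1 ci2] := ci ut _ (@const_field_smooth _ _ M (iota ut)
    (@dmap _ _ _ Mh M i (iotah ut) x)).
  move: ci1 ci2; rewrite const_field_id /iota_pi => ci1 ci2; split.
    by rewrite DhE -dmap_iota pi_starE ci1 dmap0.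
  rewrite pi_starE DhE pi_ip.
  (* Condition (i) gives this only after applying [iota_*], which is injective. *)
  have -> : @pi_star _ _ _ M Mt iota pi ut
      (D (iota ut) (@dmap _ _ _ Mh M i (iotah ut) x) Q) = 0.
    by apply: (iota_imm ut).1; rewrite dmap0.
  exact: dmap0.
have Iii : cond_ii A g -> cond_ii Ah gh.
  move=> cii j uh X Y _ _; rewrite /= /gh /pullback_metric.
  move: (X uh) (Y uh) => {X Y} x y tx ty.
  (* [p_orthE] drops [i_* p_*] in the first slot only; symmetry of [g] brings the tensor there on
     the right-hand side. *)
  rewrite -p_orthE gC [RHS]gC -p_orthE [LHS]gC [RHS]gC.
  have := cii j (i uh) _ _ (@const_field_smooth _ _ M (i uh) (dmap i x))
    (@const_field_smooth _ _ M (i uh) (dmap i y)).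
  by rewrite !const_field_id; apply.
have Iiii : cond_iii g D Q iota pi -> cond_iii gh Dh Qh iotah pih.
  move=> ciii ut X _; rewrite ghD /iota_pi; move: (X (iotah ut)) => {X} x x0.
  rewrite pi_starE => px.
  have := ciii ut _ (@const_field_smooth _ _ M (iota ut)
    (@dmap _ _ _ Mh M i (iotah ut) x)).
  rewrite const_field_id; apply.
    (* Injectivity of [i_*] keeps the vector nonzero. *)
    apply: contra x0 => /eqP ix0; apply/eqP.
    by apply: (i_imm (iotah ut)).1; rewrite ix0 dmap0.
  by rewrite /iota_pi dmap_iota px dmap0.
have Iiv : cond_iv g D Q iota pi -> cond_iv gh Dh Qh iotah pih.
  move=> civ ut X _; rewrite ghD /iota_pi; move: (X (iotah ut)) => {X} x.
  have := civ ut _ (@const_field_smooth _ _ M (iota ut)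
    (@dmap _ _ _ Mh M i (iotah ut) x)).
  (* The same constant serves: [i_*] is isometric for [gh] and sends [iotah_* pih_* x] to
     [iota_* pi_* i_* x]. *)
  rewrite const_field_id => -[l l0 gl]; exists l => //.
  have gnormE (v : Eh) : @Defs.gnorm _ _ Mh gh (iotah ut) v =
      @Defs.gnorm _ _ M g (iota ut) (@dmap _ _ _ Mh M i (iotah ut) v).
    by rewrite /Defs.gnorm /gh /pullback_metric gi.
  by rewrite gnormE dmapB -dmap_iota pi_starE.
have Iv : cond_v g D Q iota -> cond_v gh Dh Qh iotah.
  move=> cv ut X _; rewrite ghD; move: (X (iotah ut)) => {X} x.
  have := cv ut _ (@const_field_smooth _ _ M (iota ut)
    (@dmap _ _ _ Mh M i (iotah ut) x)).
  by rewrite const_field_id.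
split; last first.
  by split; [|split] => -[/Ii ci /Iii cii c]; split=> //;
    [exact: Iiii|exact: Iiv|exact: Iv].
split; last split; last split; last split; last split.
- split.
  + exact: iotah_smooth.
  + move=> ut.
    (* A continuous left inverse of [iotah_*] yields both injectivity and the split range. *)
    have iotahK : cancel (@dmap _ _ _ Mt Mh iotah ut)
        (fun v => @pi_star _ _ _ Mh Mt iotah pih ut v).
      by move=> v; rewrite pi_starE -dmap_iota pi_starK.
    split; first exact: can_inj iotahK.
    apply: (split_range_left_inverse _ _ iotahK).
      exact: dmap_continuous.
    apply: dmap_continuous.
    apply: (smooth_at_comp (h := odflt ut \o pi) (i_smooth (iotah ut))).
    by rewrite i_iotah.
  + by move=> ut wt e; apply: iota_inj; rewrite -!i_iotah e.
  + move=> O /iota_top [W oW ->]; exists (i @^-1` W).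
      by apply: open_comp => // uh _; exact: (i_smooth uh).1.
    by apply/seteqP; split=> ut; rewrite /= i_iotah.
(* [Q_zero] identifies the zeros of the reduced source with those of [Q] on the image of [i];
   injectivity of [i] then brings the points of [iota] back to [iotah]. *)
- apply/seteqP; split=> [_ [ut _ <-]|uh /= /Q_zero Q0].
    by apply/Q_zero; exact: Q_iota.
  have : range iota (i uh) by rewrite iota_Q.
  by move=> [ut _ ut_uh]; exists ut => //; apply: i_inj; rewrite i_iotah.
- apply: (open_comp (f := i) _ pi_open) => uh _; exact: (i_smooth uh).1.
- move=> uh w; rewrite /pih /= => piw.
  exact: smooth_at_comp (i_smooth uh) (pi_smooth _ _ piw).
- by move=> ut; rewrite /pih /= i_iotah.
(* Pushed forward by [i_*], this is the orthogonality of [pi] at the vector [i_* X]. *)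
- move=> ut X Yt _ _; rewrite /gh /pullback_metric !gi -!dmap_iota pi_starE.
  exact: pi_orth.
Qed.
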